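(* Let $n\ge1$ be an integer, let $A=(A_{i,j})_{1\le i,j\le n}$ be a uniformly distributed random $n\times n$ alternating sign matrix, and for an integer $k\ge0$ put $E_k=\sum_{i,j=1}^n(i-j)^kA_{i,j}$. If $k$ is odd, then \[ \mathbb{E}[E_k]=0. \]
   Context: An alternating sign matrix (ASM) of size $n$ is an $n\times n$ matrix with entries in $\{-1,0,1\}$ such that every row and every column sums to $1$ and the nonzero entries in every row and every column alternate in sign. $\mathbb{E}$ is expectation with respect to the uniform probability measure on the finite set $\mathcal{A}_n$ of $n\times n$ ASMs. *)

(* Defs.v *)
From HB Require Import structures.
From mathcomp Require Import all_boot all_order all_algebra.

Set Implicit Arguments.
Unset Strict Implicit.
Unset Printing Implicit Defensive.

Import Order.TTheory GRing.Theory Num.Theory.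
Local Open Scope ring_scope.

(* Consecutive nonzero terms of [s] have opposite signs. *)
Definition alternating (s : seq int) : bool :=
  sorted (fun x y => x * y < 0) [seq x <- s | x != 0].

(* [enum 'I_n] lists the indices in increasing order. *)
Definition row_seq n (A : 'M[int]_n) (i : 'I_n) : seq int :=
  [seq A i j | j <- enum 'I_n].

Definition col_seq n (A : 'M[int]_n) (j : 'I_n) : seq int :=
  [seq A i j | i <- enum 'I_n].

Definition is_asm n (A : 'M[int]_n) : bool :=
  [&& [forall i, forall j, A i j \in [:: -1; 0; 1]],
      [forall i, \sum_j A i j == 1],
      [forall j, \sum_i A i j == 1],
      [forall i, alternating (row_seq A i)]
    & [forall j, alternating (col_seq A j)]].

Record asm n := Asm { asm_mx :> 'M[int]_n; _ : is_asm asm_mx }.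

HB.instance Definition _ n := [isSub for @asm_mx n].
HB.instance Definition _ n := [Choice of asm n by <:].

Lemma asm_entry n (A : asm n) i j : A i j \in [:: -1; 0; 1].
Proof. by case: A => A /= /and5P[/forallP/(_ i)/forallP/(_ j)]. Qed.

(* Finiteness: an entry in {-1, 0, 1} is coded by adding 1. *)
Definition asm_code n (A : asm n) : 'M['I_3]_n :=
  \matrix_(i, j) inord (absz (A i j + 1)).

Definition asm_decode n (B : 'M['I_3]_n) : option (asm n) :=
  insub (\matrix_(i, j) ((B i j : nat)%:Z - 1)).

Lemma asm_codeK n : pcancel (@asm_code n) (@asm_decode n).
Proof.
move=> A; rewrite /asm_decode.
have -> : \matrix_(i, j) ((asm_code A i j : nat)%:Z - 1) = asm_mx A.
  apply/matrixP=> i j; rewrite !mxE.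
  by have := asm_entry A i j; rewrite !inE => /or3P[] /eqP->; rewrite inordK.
by rewrite valK.
Qed.

HB.instance Definition _ n := PCanIsCountable (@asm_codeK n).
HB.instance Definition _ n : isFinite (asm n) := PCanIsFinite (@asm_codeK n).

(* The average below is over a nonempty type. *)
Lemma is_asm1 n : is_asm (1%:M : 'M[int]_n).
Proof.
have E (i : 'I_n) (f : 'I_n -> int) : (forall j, f j = (j == i)%:R) ->
    (\sum_j f j == 1) && alternating [seq f j | j <- enum 'I_n].
  move=> fE; rewrite (bigD1 i) //= fE eqxx big1 ?addr0 ?eqxx /=; last first.
    by move=> j /negPf ji; rewrite fE ji.
  rewrite /alternating filter_map (eq_filter (a2 := pred1 i)).
    by rewrite filter_pred1_uniq ?enum_uniq ?mem_enum.
  by move=> j /=; rewrite fE; case: (j == i).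
have Er i : (\sum_j (1%:M : 'M[int]_n) i j == 1) &&
    alternating (row_seq 1%:M i) by apply: E => j; rewrite mxE eq_sym.
have Ec j : (\sum_i (1%:M : 'M[int]_n) i j == 1) &&
    alternating (col_seq 1%:M j) by apply: E => i; rewrite mxE.
apply/and5P; split; apply/forallP=> i.
- by apply/forallP=> j; rewrite mxE; case: (i == j).
- by case/andP: (Er i).
- by case/andP: (Ec i).
- by case/andP: (Er i).
- by case/andP: (Ec i).
Qed.

Lemma card_asm_gt0 n : (0 < #|{: asm n}|)%N.
Proof. by apply/card_gt0P; exists (Asm (is_asm1 n)). Qed.

Definition uniform_expectation (R : realFieldType) (T : finType) (X : T -> R) : R :=
  \sum_(t : T) #|T|%:R^-1 * X t.

(* Indices in 'I_n start at 0, which does not affect i - j. *)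
Definition asm_moment n (k : nat) (A : 'M[int]_n) : int :=
  \sum_(i < n) \sum_(j < n) ((i : nat)%:Z - (j : nat)%:Z) ^+ k * A i j.

(* Main.v *)
Require Import Defs.
From mathcomp Require Import all_boot all_order all_algebra.

(** Transposition is an involution on alternating sign matrices, since it
    exchanges the conditions on rows with those on columns.  It replaces
    [i - j] by [j - i], so for odd [k] it changes the sign of the moment
    [E_k] ([asm_moment_tr]).  The uniform measure is invariant under every
    bijection, so the expectation of [E_k] is its own opposite
    ([uniform_expectation_odd]), hence zero. *)

Local Open Scope ring_scope.
Import GRing.Theory Num.Theory.

Lemma is_asm_tr n (A : 'M[int]_n) : is_asm A -> is_asm A^T.
Proof.
case/and5P=> /forallP entryA /forallP sumr /forallP sumc /forallP altr /forallP altc.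
apply/and5P; split; apply/forallP=> i.
- by apply/forallP=> j; rewrite mxE; apply: (forallP (entryA j)).
- by rewrite -(eqP (sumc i)); apply/eqP; apply: eq_bigr => j _; rewrite mxE.
- by rewrite -(eqP (sumr i)); apply/eqP; apply: eq_bigr => j _; rewrite mxE.
- suff -> : row_seq A^T i = col_seq A i by [].
  by apply: eq_map => j; rewrite mxE.
- suff -> : col_seq A^T i = row_seq A i by [].
  by apply: eq_map => j; rewrite mxE.
Qed.

(** Transposition as a map from alternating sign matrices to themselves. *)
Definition asm_tr n (A : asm n) : asm n := Asm (is_asm_tr n A (valP A)).

Lemma asm_trK n : involutive (@asm_tr n).
Proof. by move=> A; apply: val_inj; rewrite /= trmxK. Qed.

Lemma asm_moment_tr n k (A : 'M[int]_n) :
  odd k -> asm_moment k A^T = - asm_moment k A.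
Proof.
move=> hk; rewrite /asm_moment exchange_big /= -sumrN.
apply: eq_bigr => i _; rewrite -sumrN; apply: eq_bigr => j _.
by rewrite mxE -opprB exprNn -signr_odd hk expr1 mulN1r mulNr.
Qed.

Lemma uniform_expectation_odd (R : realFieldType) (T : finType) (f : T -> T)
    (X : T -> R) :
  bijective f -> (forall t, X (f t) = - X t) -> uniform_expectation X = 0.
Proof.
move=> bij_f Xf; apply/eqP; rewrite -eqNr; apply/eqP.
rewrite {2}/uniform_expectation (reindex f) /=; last exact: onW_bij.
by rewrite /uniform_expectation -sumrN; apply: eq_bigr => t _; rewrite Xf mulrN.
Qed.

Theorem theorem7p1 (R : realFieldType) (n k : nat) (hn : (1 <= n)%N)
    (hk : odd k) :
  uniform_expectation (fun A : asm n => (asm_moment k A)%:~R : R) = 0.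
Proof.
apply: (@uniform_expectation_odd _ _ (@asm_tr n)).
  exact: inv_bij (@asm_trK n).
by move=> A; rewrite asm_moment_tr // mulrNz.
Qed.
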